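(* Let $(X,d_X)$ and $(Y,d_Y)$ be (nonempty) finite metric spaces, and equip $X\times Y$ with the sum metric $d_X+d_Y$. Then for all $n\ge 0$ the interleaving distance between the persistence vector spaces $PH_n(X,Y)$ and $PH_n(X\times Y)$ is less than or equal to $$\min(\mathrm{diameter}(X),\mathrm{diameter}(Y)),$$ where $\mathrm{diameter}(X)=\max\{d_X(x_0,x_1)\mid x_0,x_1\in X\}$ and similarly for $Y$.
   Context: Let $\kappa$ be a field and $\mathbb{R}_+=[0,\infty)$. $\kappa[\mathbb{R}_+]$ is the ring of polynomials in one variable $T$ with exponents in $\mathbb{R}_+$ and coefficients in $\kappa$, graded by $\mathbb{R}_+$ with $T^t$ in degree $t$. $\Gamma^a\kappa[\mathbb{R}_+]$ is the free graded module on one generator of degree $a$. For a metric space $(X,d_X)$, let $\mathbf{X}$ be the simplicial set with $\mathbf{X}_n=X^{n+1}$ (ordered tuples, repetitions allowed), with $\mathbf{X}_\varphi(x_0,\dots,x_n)=(x_{\varphi(0)},\dots,x_{\varphi(m)})$ for weakly order-preserving $\varphi:[m]\to[n]$, and let $l_X(x_0,\dots,x_n)=\max_{i,j}d_X(x_i,x_j)$. For a simplicial set $\mathbf{Z}$ with a function $l:\mathbf{Z}_n\to\mathbb{R}_+$ $(n\ge0)$ satisfying $l(\mathbf{Z}_\varphi(\sigma))\le l(\sigma)$ for all structure maps, $PC_*(\mathbf{Z},l)$ is the chain complex $PC_n(\mathbf{Z},l)=\bigoplus_{\sigma\in\mathbf{Z}_n}\Gamma^{l(\sigma)}\kappa[\mathbb{R}_+]\cdot\langle\sigma\rangle$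 with differential $d\langle\sigma\rangle=\sum_{i=0}^n(-1)^iT^{l(\sigma)-l(d_i\sigma)}\langle d_i\sigma\rangle$, and $PH_n(\mathbf{Z},l)$ is its homology, an $\mathbb{R}_+$-graded $\kappa[\mathbb{R}_+]$-module. Define $PH_n(X\times Y)=PH_n(\mathbf{X}\times\mathbf{Y},l_{X\times Y})$, where $\mathbf{X}\times\mathbf{Y}$ is the levelwise product and $l_{X\times Y}$ is the max-length function of the sum metric, i.e. $l_{X\times Y}((x_0,\dots,x_n),(y_0,\dots,y_n))=\max_{i,j}\big(d_X(x_i,x_j)+d_Y(y_i,y_j)\big)$; and $PH_n(X,Y)=PH_n(\mathbf{X}\times\mathbf{Y},l_X+l_Y)$, where $(l_X+l_Y)(\sigma,\tau)=l_X(\sigma)+l_Y(\tau)$. A graded $\kappa[\mathbb{R}_+]$-module $M$ is viewed as the persistence vector space $t\mapsto M_t$ (degree-$t$ part), $t\in\mathbb{R}_+$, with structure maps $M_t\to M_{t'}$, $t\le t'$, given by multiplication by $T^{t'-t}$. For $\delta\ge0$, persistence vector spaces $V$ and $W$ with structure maps $l_{t,t'}:V_t\to V_{t'}$ and $s_{t,t'}:W_t\to W_{t'}$ are $\delta$-interleaved if there are linear maps $F_t:V_t\to W_{t+\delta}$ and $G_t:W_t\to V_{t+\delta}$ $(t\in\mathbb{R}_+)$ such that for all $t\le t'$: $l_{t+\delta,t'+\delta}\circ G_t=G_{t'}\circ s_{t,t'}$, $s_{t+\delta,t'+\delta}\circ F_t=F_{t'}\circ l_{t,t'}$, $G_{t+\delta}\circ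 F_t=l_{t,t+2\delta}$, and $F_{t+\delta}\circ G_t=s_{t,t+2\delta}$. The interleaving distance is the infimum of all $\delta\ge0$ such that $V$ and $W$ are $\delta$-interleaved. *)

(* Defs.v *)
From HB Require Import structures.
From mathcomp Require Import all_boot all_order all_algebra finmap.
From mathcomp Require Import multinomials.monalg.
From mathcomp Require Import boolp classical_sets reals constructive_ereal ereal.
From mathcomp Require Import topology metric_structure.

Set Implicit Arguments.
Unset Strict Implicit.
Unset Printing Implicit Defensive.

From mathcomp Require Import zify.

Import Order.TTheory GRing.Theory Num.Theory.
Local Open Scope ring_scope.

Definition Rge0 (R : realType) := {x : R | 0 <= x}.

Section Rge0.
Variable R : realType.
Implicit Types s t : Rge0 R.

HB.instance Definition _ := SubChoice.on (Rge0 R).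
HB.instance Definition _ :=
  [SubChoice_isSubOrder of Rge0 R by <: with ring_display].

Definition Rge00 : Rge0 R := exist _ 0 (lexx 0).
Definition Rge0_add s t : Rge0 R :=
  exist _ (val s + val t) (addr_ge0 (valP s) (valP t)).

Let addA : associative Rge0_add.
Proof. by move=> r s t; apply: val_inj; rewrite /= addrA. Qed.
Let addC : commutative Rge0_add.
Proof. by move=> s t; apply: val_inj; rewrite /= addrC. Qed.
Let add0 : left_id Rge00 Rge0_add.
Proof. by move=> s; apply: val_inj; rewrite /= add0r. Qed.

HB.instance Definition _ := GRing.isNmodule.Build (Rge0 R) addA addC add0.

Fact Rge0_sub_ge0 s t : 0 <= Num.max (val s - val t) 0.
Proof. by rewrite le_max lexx orbT. Qed.

(* Truncated difference; it is only used with [t <= s]. *)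
Definition Rge0_sub s t : Rge0 R := exist (fun x : R => 0 <= x) _ (Rge0_sub_ge0 s t).

Lemma val_Rge0D s t : val (s + t) = val s + val t. Proof. by []. Qed.

Lemma Rge0_leE s t : (s <= t) = (val s <= val t).
Proof. by rewrite leEsub. Qed.

Lemma Rge0_subK s t : s <= t -> s + Rge0_sub t s = t.
Proof.
rewrite Rge0_leE => st; apply: val_inj.
by rewrite val_Rge0D /= (max_idPl _) ?subr_ge0 // addrC subrK.
Qed.

Lemma Rge0_le_addr s t : s <= s + t.
Proof. by rewrite Rge0_leE val_Rge0D lerDl; apply: valP. Qed.

Lemma Rge0_le_add2r d s t : s <= t -> s + d <= t + d.
Proof. by rewrite !Rge0_leE !val_Rge0D lerD2r. Qed.

Lemma Rge0_addI : right_injective (@GRing.add (Rge0 R)).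
Proof.
move=> r s t /(congr1 val); rewrite !val_Rge0D => /addrI h.
exact: val_inj.
Qed.

Let addr0' : right_id (0 : Rge0 R) +%R. Proof. exact: addr0. Qed.
Let unit0 s t : s + t = 0 -> s = 0 /\ t = 0.
Proof.
move=> /(congr1 val)/eqP; rewrite val_Rge0D.
rewrite paddr_eq0 ?(valP s) ?(valP t) // => /andP[/eqP s0 /eqP t0].
by split; apply: val_inj.
Qed.

HB.instance Definition _ := Choice_isMonomialDef.Build (Rge0 R)
  (@addrA (Rge0 R)) (@add0r (Rge0 R)) addr0' unit0.
HB.instance Definition _ :=
  MonomialDef_isConomialDef.Build (Rge0 R) (@addrC (Rge0 R)).

End Rge0.

(* The monoid algebra of the additive monoid Rge0; in it << a *g t >> is the   *)
(* monomial a T^t.                                                            *)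
Notation polyRge0 K R := {malg K[Rge0 R]}.

Definition Tpow (K : fieldType) (R : realType) (t : Rge0 R) :
  polyRge0 K R := << t >>.

Record gradedMod (K : fieldType) (R : realType) := GradedMod {
  gm_sort :> lmodType (polyRge0 K R);
  gm_deg : Rge0 R -> {pred gm_sort};
  gm_degB : forall t, zmod_closed (gm_deg t);
  gm_degZ : forall (a : K) s t x, x \in gm_deg t ->
    (<< a *g s >> : polyRge0 K R) *: x \in gm_deg (t + s);
  (* the last two fields say that the module is the direct sum of its parts *)
  gm_dec : forall x : gm_sort, exists r (m : Rge0 R -> gm_sort),
    [/\ uniq r, forall t, m t \in gm_deg t & x = \sum_(t <- r) m t];
  gm_indep : forall r (m : Rge0 R -> gm_sort),
    uniq r -> (forall t, m t \in gm_deg t) -> \sum_(t <- r) m t = 0 ->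
    forall t, t \in r -> m t = 0
}.

Arguments gm_deg {K R} M t : rename.

Section GradedPart.
Variables (K : fieldType) (R : realType) (M : gradedMod K R).
Implicit Types (t : Rge0 R) (a b : K).

HB.instance Definition _ t :=
  GRing.isZmodClosed.Build M (gm_deg M t) (@gm_degB K R M t).

Lemma gm_degK a t (x : M) :
  x \in gm_deg M t -> (a%:MP : polyRge0 K R) *: x \in gm_deg M t.
Proof. by move=> /(@gm_degZ _ _ M a 0 t x); rewrite addr0. Qed.

Definition gm_part t : Type := {x : M | x \in gm_deg M t}.

HB.instance Definition _ t := SubChoice.on (gm_part t).
HB.instance Definition _ t := [SubChoice_isSubZmodule of gm_part t by <:].

Definition gm_part_scale t a (x : gm_part t) : gm_part t :=
  exist (fun y : M => y \in gm_deg M t) _ (gm_degK a (valP x)).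

Section Lmod.
Variable t : Rge0 R.
Let scaleA a b (x : gm_part t) :
  gm_part_scale a (gm_part_scale b x) = gm_part_scale (a * b) x.
Proof. by apply: val_inj; rewrite /= scalerA mpolyCM. Qed.
Let scale1 : left_id 1 (@gm_part_scale t).
Proof. by move=> x; apply: val_inj; rewrite /= scale1r. Qed.
Let scaleDr : right_distributive (@gm_part_scale t) +%R.
Proof. by move=> a x y; apply: val_inj; rewrite /= scalerDr. Qed.
Let scaleDl (x : gm_part t) : {morph (@gm_part_scale t)^~ x : a b / a + b}.
Proof. by move=> a b; apply: val_inj; rewrite /= monalgUD scalerDl. Qed.
HB.instance Definition _ :=
  GRing.Zmodule_isLmodule.Build K (gm_part t) scaleA scale1 scaleDr scaleDl.
End Lmod.

Lemma Tpow_deg t t' (x : gm_part t) :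
  t <= t' -> Tpow K (Rge0_sub t' t) *: val x \in gm_deg M t'.
Proof.
move=> tt'; have := gm_degZ 1 (Rge0_sub t' t) (valP x).
by rewrite Rge0_subK.
Qed.

Definition gm_map t t' (tt' : t <= t') (x : gm_part t) : gm_part t' :=
  exist (fun y : M => y \in gm_deg M t') _ (Tpow_deg x tt').

Fact gm_map_is_linear t t' (tt' : t <= t') : linear (gm_map tt').
Proof.
move=> a x y; apply: val_inj; rewrite /= scalerDr; congr (_ + _).
by rewrite !scalerA mulrC.
Qed.
HB.instance Definition _ t t' (tt' : t <= t') :=
  GRing.isLinear.Build K (gm_part t) (gm_part t') *:%R (gm_map tt')
    (gm_map_is_linear tt').

End GradedPart.

Record persVect (K : fieldType) (R : realType) := PersVect {
  pv_sp :> Rge0 R -> lmodType K;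
  pv_map : forall t t', t <= t' -> {linear pv_sp t -> pv_sp t'};
  pv_map_id : forall t (h : t <= t) v, pv_map h v = v;
  pv_map_comp : forall t1 t2 t3 (h12 : t1 <= t2) (h23 : t2 <= t3)
    (h13 : t1 <= t3) v, pv_map h23 (pv_map h12 v) = pv_map h13 v
}.

Arguments pv_map {K R} V {t t'} h : rename.

Section PersOfGraded.
Variables (K : fieldType) (R : realType) (M : gradedMod K R).
Implicit Types t : Rge0 R.

Lemma Tpow0 : Tpow K (0 : Rge0 R) = 1. Proof. by []. Qed.
Lemma TpowD s t : Tpow K (s + t) = Tpow K s * Tpow K t.
Proof. by rewrite /Tpow malgM_def fgmulUU mulr1. Qed.

Lemma gm_map_id t (tt : t <= t) (x : gm_part M t) : gm_map tt x = x.
Proof.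
apply: val_inj; rewrite /=.
have -> : Rge0_sub t t = 0 by apply: (@Rge0_addI _ t); rewrite Rge0_subK ?addr0.
by rewrite Tpow0 scale1r.
Qed.

Lemma gm_map_comp t1 t2 t3 (h12 : t1 <= t2) (h23 : t2 <= t3) (h13 : t1 <= t3)
  (x : gm_part M t1) : gm_map h23 (gm_map h12 x) = gm_map h13 x.
Proof.
apply: val_inj; rewrite /= scalerA -TpowD; congr (Tpow _ _ *: _).
by apply: (@Rge0_addI _ t1); rewrite addrCA !Rge0_subK // addrC Rge0_subK.
Qed.

Definition pers_of_graded : persVect K R :=
  @PersVect K R (fun t => gm_part M t : lmodType K)
    (fun t t' h => gm_map h : {linear _ -> _}) gm_map_id gm_map_comp.

End PersOfGraded.

Section Interleaving.
Variables (K : fieldType) (R : realType).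

Definition interleaved (d : Rge0 R) (V W : persVect K R) : Prop :=
  exists (F : forall t, {linear V t -> W (t + d)})
         (G : forall t, {linear W t -> V (t + d)}),
  [/\ forall t t' (h : t <= t') w,
        pv_map V (Rge0_le_add2r d h) (G t w) = G t' (pv_map W h w),
      forall t t' (h : t <= t') v,
        pv_map W (Rge0_le_add2r d h) (F t v) = F t' (pv_map V h v),
      forall t v, G (t + d) (F t v) =
        pv_map V (le_trans (Rge0_le_addr t d) (Rge0_le_addr (t + d) d)) v
    & forall t w, F (t + d) (G t w) =
        pv_map W (le_trans (Rge0_le_addr t d) (Rge0_le_addr (t + d) d)) w].

(* Extended-real infimum, so it is +oo when V and W are never interleaved. *)
Definition interleaving_dist (V W : persVect K R) : \bar R :=
  ereal_inf [set (val d)%:E | d in [set d | interleaved d V W]].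

End Interleaving.

Section LmodQuot.
Variables (A : nzRingType) (M : lmodType A) (N : {pred M}).
Hypothesis Nmod : submod_closed N.

Definition submod_pred of submod_closed N : {pred M} := N.
HB.instance Definition _ :=
  GRing.isZmodClosed.Build M (submod_pred Nmod) (GRing.submod_closedB Nmod).

Definition lmod_quot := Quotient.quot (submod_pred Nmod).
Local Notation Q := lmod_quot.
HB.instance Definition _ := GRing.Zmodule.on Q.
HB.instance Definition _ := EqQuotient.on Q.
Local Open Scope quotient_scope.

Definition lmod_pi (x : M) : Q := \pi_Q x.

Lemma lmod_pi_surj (q : Q) : exists x, q = lmod_pi x.
Proof. by exists (repr q); rewrite /lmod_pi reprK. Qed.

Lemma lmod_piP (x y : M) : reflect (lmod_pi x = lmod_pi y) (x - y \in N).
Proof.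
rewrite -[_ \in N]/(_ \in submod_pred Nmod) Quotient.idealrBE.
exact: eqP.
Qed.

Lemma lmod_piD (x y : M) : lmod_pi (x + y) = lmod_pi x + lmod_pi y.
Proof. exact: (@Quotient.pi_add _ (submod_pred Nmod)). Qed.

Definition quot_scale (a : A) (q : Q) : Q := lmod_pi (a *: repr q).

Lemma quot_scaleE a (x : M) : quot_scale a (lmod_pi x) = lmod_pi (a *: x).
Proof.
apply/lmod_piP; rewrite -scalerBr -[_ *: _]addr0.
apply: Nmod.2; last exact: Nmod.1.
by apply/lmod_piP; rewrite /lmod_pi reprK.
Qed.

Let scaleA a b q : quot_scale a (quot_scale b q) = quot_scale (a * b) q.
Proof. by have [x ->] := lmod_pi_surj q; rewrite !quot_scaleE scalerA. Qed.
Let scale1 : left_id 1 quot_scale.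
Proof. by move=> q; have [x ->] := lmod_pi_surj q; rewrite quot_scaleE scale1r. Qed.
Let scaleDr : right_distributive quot_scale +%R.
Proof.
move=> a p q; have [x ->] := lmod_pi_surj p; have [y ->] := lmod_pi_surj q.
by rewrite -lmod_piD !quot_scaleE scalerDr lmod_piD.
Qed.
Let scaleDl q : {morph quot_scale^~ q : a b / a + b}.
Proof.
move=> a b; have [x ->] := lmod_pi_surj q.
by rewrite !quot_scaleE scalerDl lmod_piD.
Qed.
HB.instance Definition _ :=
  GRing.Zmodule_isLmodule.Build A Q scaleA scale1 scaleDr scaleDl.

Fact lmod_pi_is_linear : linear lmod_pi.
Proof. by move=> a x y; rewrite lmod_piD -quot_scaleE. Qed.
HB.instance Definition _ :=
  GRing.isLinear.Build A M Q *:%R lmod_pi lmod_pi_is_linear.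

End LmodQuot.

Record grComplex (K : fieldType) (R : realType) := GrComplex {
  gc_ob :> nat -> gradedMod K R;
  gc_d : forall n, {linear gc_ob n.+1 -> gc_ob n};
  gc_d_deg : forall n t x,
    x \in gm_deg (gc_ob n.+1) t -> gc_d n x \in gm_deg (gc_ob n) t;
  gc_dd : forall n x, gc_d n (gc_d n.+1 x) = 0
}.

Arguments gc_d {K R} C n : rename.

Lemma sum_if_mem (V : zmodType) (I : eqType) (q r : seq I) (f : I -> V) :
  uniq q -> uniq r -> {subset q <= r} ->
  \sum_(i <- r) (if i \in q then f i else 0) = \sum_(i <- q) f i.
Proof.
move=> q_uniq r_uniq qr; rewrite -big_mkcond -big_filter.
apply: perm_big; apply: uniq_perm; rewrite ?filter_uniq // => i.
by rewrite mem_filter; case: (boolP (i \in q)) => //= /qr.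
Qed.

Section Homology.
Variables (K : fieldType) (R : realType) (C : grComplex K R).
Implicit Types (n : nat) (t : Rge0 R).

(* The complex is concentrated in nonnegative degrees: every 0-chain is a      *)
(* cycle.                                                                     *)
Definition cycle n : {pred C n} :=
  match n return {pred C n} with
  | 0 => predT
  | m.+1 => [pred x | gc_d C m x == 0]
  end.

Fact cycle_submod n : submod_closed (@cycle n).
Proof.
case: n => [|n] /=; first by split.
split=> [|a x y]; first by rewrite inE linear0.
by rewrite !inE => /eqP dx /eqP dy; rewrite linearP dx dy scaler0 addr0.
Qed.
HB.instance Definition _ n :=
  GRing.isSubmodClosed.Build _ (gm_sort (C n)) (@cycle n) (@cycle_submod n).

Definition cycles n : Type := {x : C n | x \in @cycle n}.
HB.instance Definition _ n := SubChoice.on (cycles n).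
HB.instance Definition _ n := [SubChoice_isSubLmodule of cycles n by <:].

Definition boundary n : {pred cycles n} :=
  fun z => `[< exists b, val z = gc_d C n b >].

Fact boundary_submod n : submod_closed (@boundary n).
Proof.
split=> [|a x y]; first by apply/asboolP; exists 0; rewrite linear0.
move=> /asboolP[b xb] /asboolP[c yc]; apply/asboolP; exists (a *: b + c).
by rewrite linearP -xb -yc.
Qed.

Definition homology n := lmod_quot (@boundary_submod n).

Definition homology_deg n t : {pred homology n} :=
  fun h => `[< exists2 z : cycles n,
    val z \in gm_deg (C n) t & h = lmod_pi (@boundary_submod n) z >].

Local Notation cls n := (lmod_pi (@boundary_submod n)).

Fact homology_degB n t : zmod_closed (@homology_deg n t).
Proof.
split; first by apply/asboolP; exists 0; rewrite ?linear0 //= rpred0.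
move=> _ _ /asboolP[x xt ->] /asboolP[y yt ->]; apply/asboolP.
by exists (x - y); rewrite ?linearB //= rpredB.
Qed.

Fact homology_degZ n (a : K) s t h : h \in @homology_deg n t ->
  (<< a *g s >> : polyRge0 K R) *: h \in @homology_deg n (t + s).
Proof.
move=> /asboolP[x xt ->]; apply/asboolP.
by exists (<< a *g s >> *: x); rewrite ?linearZ //= gm_degZ.
Qed.

Fact homology_dec n (h : homology n) : exists r (m : Rge0 R -> homology n),
  [/\ uniq r, forall t, m t \in @homology_deg n t & h = \sum_(t <- r) m t].
Proof.
have [z ->] := lmod_pi_surj h.
have [r [m [r_uniq mt zE]]] := gm_dec (val z).
have m_cycle t : t \in r -> m t \in @cycle n.
  move: {h} m mt z zE t; case: n => [|n] m mt z zE t // tr.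
  rewrite inE; apply/eqP.
  apply: (gm_indep (m := fun t => gc_d C n (m t)) r_uniq) => // [u|].
    exact: gc_d_deg.
  by rewrite -linear_sum -zE; apply/eqP; have := valP z; rewrite inE.
pose m' t : cycles n := insubd 0 (m t).
have m'E t : t \in r -> val (m' t) = m t by move=> /m_cycle mc; rewrite insubdK.
exists r, (fun t => cls n (m' t)); split=> // [t|].
  apply/asboolP; exists (m' t) => //; rewrite val_insubd.
  by case: ifP => _; rewrite ?mt // rpred0.
rewrite -linear_sum; congr (cls n _); apply: val_inj.
by rewrite zE raddf_sum /=; apply: eq_big_seq => t /m'E.
Qed.

Fact homology_indep n r (m : Rge0 R -> homology n) :
  uniq r -> (forall t, m t \in @homology_deg n t) -> \sum_(t <- r) m t = 0 ->
  forall t, t \in r -> m t = 0.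
Proof.
move=> r_uniq mt m0.
have /choice[z zP] t : exists z : cycles n,
    val z \in gm_deg (C n) t /\ m t = cls n z.
  by have /asboolP[z] := mt t; exists z.
have : cls n (\sum_(t <- r) z t) = cls n 0.
  rewrite linear_sum linear0 -[RHS]m0; apply: eq_bigr => t _.
  by rewrite (zP t).2.
move=> /lmod_piP; rewrite subr0 => /asboolP[b].
have [r' [b' [r'_uniq bt ->]]] := gm_dec b.
rewrite linear_sum raddf_sum /= => zb t tr.
pose w s := (if s \in r then val (z s) else 0)
            - gc_d C n (if s \in r' then b' s else 0).
have ws s : w s \in gm_deg (C n) s.
  rewrite rpredB //; first by case: ifP => _; [exact: (zP s).1 | exact: rpred0].
  by apply: gc_d_deg; case: ifP => _; [exact: bt | exact: rpred0].
have w0 : \sum_(s <- undup (r ++ r')) w s = 0.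
  rewrite sumrB /= -linear_sum !sum_if_mem ?undup_uniq //.
  - by rewrite zb (linear_sum (gc_d C n)) subrr.
  - by move=> s sr; rewrite mem_undup mem_cat sr orbT.
  - by move=> s sr; rewrite mem_undup mem_cat sr.
have := gm_indep (undup_uniq _) ws w0 (t := t).
rewrite mem_undup mem_cat tr => /(_ isT); rewrite /w tr => /eqP.
rewrite subr_eq0 => /eqP ztE; rewrite (zP t).2 -(linear0 (cls n)).
apply/lmod_piP; rewrite subr0; apply/asboolP.
by exists (if t \in r' then b' t else 0).
Qed.

Definition homology_graded n : gradedMod K R :=
  @GradedMod K R (homology n) (@homology_deg n) (@homology_degB n)
    (@homology_degZ n) (@homology_dec n) (@homology_indep n).

End Homology.

Record sset := SSet {
  ss_ob :> nat -> choiceType;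
  ss_map : forall m n, {omorphism 'I_m.+1 -> 'I_n.+1} -> ss_ob n -> ss_ob m;
  ss_id : forall n x, ss_map (idfun : {omorphism 'I_n.+1 -> 'I_n.+1}) x = x;
  ss_comp : forall m n p (f : {omorphism 'I_n.+1 -> 'I_p.+1})
    (g : {omorphism 'I_m.+1 -> 'I_n.+1}) x,
    ss_map (f \o g : {omorphism _ -> _}) x = ss_map g (ss_map f x)
}.

Lemma ss_map_ext (Z : sset) m n (f g : {omorphism 'I_m.+1 -> 'I_n.+1})
  (x : Z n) : f =1 g -> ss_map f x = ss_map g x.
Proof.
move=> fg; suff -> : f = g by [].
case: f g fg => [f [[fP]]] [g [[gP]]] /= /funext fg; case: _ / fg gP => gP.
by rewrite (Prop_irrelevance fP gP).
Qed.

Definition coface n (i : 'I_n.+2) (j : 'I_n.+1) : 'I_n.+2 := lift i j.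

Fact coface_homo n (i : 'I_n.+2) : {homo coface i : j k / (j <= k)%O}.
Proof. by move=> j k; rewrite !leEord /= leq_bump2. Qed.
HB.instance Definition _ n (i : 'I_n.+2) :=
  Order.isOrderMorphism.Build _ 'I_n.+1 _ 'I_n.+2 (coface i) (@coface_homo n i).

Definition face (Z : sset) n (i : 'I_n.+2) : Z n.+1 -> Z n :=
  ss_map (coface i : {omorphism 'I_n.+1 -> 'I_n.+2}).

Lemma face_face (Z : sset) n (i : 'I_n.+3) (j : 'I_n.+2) (i' : 'I_n.+3)
  (j' : 'I_n.+2) (x : Z n.+2) :
  (j < i)%N -> i' = j :> nat -> j' = i.-1 :> nat ->
  face j (face i x) = face j' (face i' x).
Proof.
move=> ji i'j j'i; rewrite /face -!ss_comp; apply: ss_map_ext => k.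
apply: val_inj; rewrite /= i'j j'i /bump; move: ji.
by do 4![case: leqP]; lia.
Qed.

Record fsset (R : realType) := FSSet {
  fs_sset :> sset;
  len : forall n, fs_sset n -> Rge0 R;
  len_le : forall m n (f : {omorphism 'I_m.+1 -> 'I_n.+1}) (x : fs_sset n),
    len (ss_map f x) <= len x
}.

Section PersistenceComplex.
Variables (K : fieldType) (R : realType) (Z : fsset R).
Implicit Types (n : nat) (s t : Rge0 R).
Local Notation A := (polyRge0 K R).

(* Finitely supported functions Z n -> A: the free A-module on Z n. *)
Definition PC_mod n : lmodType A := {malg A[Z n]}.

(* << x >> generates a copy of the base ring shifted by len x, so T^s << x >>   *)
(* has degree len x + s.                                                      *)
Definition PC_deg n t : {pred PC_mod n} :=
  fun c => `[< forall x s, s \in msupp (c@_x) -> len x + s = t >].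

Definition PC_dgen n (x : Z n.+1) : PC_mod n :=
  \sum_(i < n.+2)
    << (-1) ^+ i * Tpow K (Rge0_sub (len x) (len (face i x))) *g face i x >>.

Definition PC_d n (c : PC_mod n.+1) : PC_mod n :=
  \sum_(x <- msupp c) c@_x *: PC_dgen x.

Lemma PC_dEw n (D : {fset Z n.+1}) (c : PC_mod n.+1) :
  (msupp c `<=` D)%fset -> PC_d c = \sum_(x <- D) c@_x *: PC_dgen x.
Proof.
move=> cD; rewrite /PC_d (big_fset_incl _ cD) // => x _ xc.
by rewrite mcoeff_outdom // scale0r.
Qed.

Fact PC_d_is_linear n : linear (@PC_d n).
Proof.
move=> a x y; pose D := (msupp x `|` msupp y)%fset.
have xD : (msupp x `<=` D)%fset by apply: fsubsetUl.
have yD : (msupp y `<=` D)%fset by apply: fsubsetUr.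
have axyD : (msupp (a *: x + y) `<=` D)%fset.
  apply: fsubset_trans (msuppD_le _ _) _.
  by apply: fsetSU; apply: msuppZ_le.
rewrite (PC_dEw axyD) (PC_dEw xD) (PC_dEw yD) scaler_sumr -big_split /=.
apply: eq_bigr => z _.
by rewrite mcoeffD mcoeffZ scalerDl scalerA.
Qed.
HB.instance Definition _ n :=
  GRing.isLinear.Build A (PC_mod n.+1) (PC_mod n) *:%R (@PC_d n)
    (@PC_d_is_linear n).

Lemma PC_dU n a (x : Z n.+1) : PC_d << a *g x >> = a *: PC_dgen x.
Proof. by rewrite (PC_dEw msuppU_le) big_seq_fset1 mcoeffUU. Qed.

Lemma malgZU n a b (x : Z n) :
  a *: (<< b *g x >> : PC_mod n) = << a * b *g x >>.
Proof.
apply/malgP => y; rewrite mcoeffZ !mcoeffU.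
by case: eqP; rewrite ?mulr1n ?mulr0n ?mulr0.
Qed.

Lemma PC_degP n t (c : PC_mod n) :
  reflect (forall x s, len x + s != t -> c@_x@_s = 0) (c \in @PC_deg n t).
Proof.
apply: (iffP (asboolP _)) => h x s.
  by move=> st; apply: mcoeff_outdom; apply: contra st => /h ->.
by rewrite -mcoeff_neq0 => nz; apply: contraNeq nz => /h ->.
Qed.

Fact PC_degB n t : zmod_closed (@PC_deg n t).
Proof.
split; first by apply/PC_degP => x s _; rewrite !mcoeff0.
move=> c e /PC_degP cP /PC_degP eP; apply/PC_degP => x s xs.
by rewrite !mcoeffB cP ?eP ?subr0.
Qed.

Fact PC_degZ n (a : K) s t c :
  c \in @PC_deg n t -> (<< a *g s >> : A) *: c \in @PC_deg n (t + s).
Proof.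
move=> /asboolP cP; apply/asboolP => x u; rewrite mcoeffZ => /msuppM_le.
move=> [v [w [/(fsubsetP msuppU_le)]]]; rewrite in_fset1 => /eqP -> wc ->.
by rewrite -(cP _ _ wc) -addrA; congr (_ + _); apply: addrC.
Qed.

HB.instance Definition _ n t :=
  GRing.isZmodClosed.Build (PC_mod n) (@PC_deg n t) (@PC_degB n t).

Lemma PC_degU n a s (x : Z n) :
  << << a *g s >> *g x >> \in @PC_deg n (len x + s).
Proof.
apply/PC_degP => y u; rewrite mcoeffU; case: (eqVneq x y) => [<-|_].
  by rewrite mcoeffU; case: (eqVneq s u) => [->|//]; rewrite eqxx.
by rewrite mcoeff0.
Qed.

Let has_dec n (c : PC_mod n) := exists r (m : Rge0 R -> PC_mod n),
  [/\ uniq r, forall t, m t \in @PC_deg n t & c = \sum_(t <- r) m t].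

Let has_decD n (c e : PC_mod n) : has_dec c -> has_dec e -> has_dec (c + e).
Proof.
move=> [r [f [r_uniq fP ->]]] [q [g [q_uniq gP ->]]].
exists (undup (r ++ q)), (fun t => (if t \in r then f t else 0)
                                 + (if t \in q then g t else 0)).
split; [exact: undup_uniq | |].
  by move=> t; rewrite rpredD //; case: ifP => _; rewrite ?rpred0.
rewrite big_split /= !sum_if_mem ?undup_uniq // => t tr.
  by rewrite mem_undup mem_cat tr orbT.
by rewrite mem_undup mem_cat tr.
Qed.

Fact PC_dec n (c : PC_mod n) : has_dec c.
Proof.
have dec0 : has_dec (0 : PC_mod n).
  by exists [::], (fun=> 0); split=> // [t|]; rewrite ?rpred0 ?big_nil.
rewrite [c]monalgE; apply: (big_ind (@has_dec n)) => // [|x _].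
  exact: has_decD.
rewrite [c@_x]monalgE raddf_sum.
apply: (big_ind (@has_dec n)) => // [|s _]; first exact: has_decD.
exists [:: len x + s], (fun t => if t == len x + s then
  << << c@_x@_s *g s >> *g x >> else 0).
split=> // [t|]; last by rewrite big_seq1 eqxx.
by case: eqP => [->|_]; [exact: PC_degU | rewrite rpred0].
Qed.

Fact PC_indep n r (m : Rge0 R -> PC_mod n) :
  uniq r -> (forall t, m t \in @PC_deg n t) -> \sum_(t <- r) m t = 0 ->
  forall t, t \in r -> m t = 0.
Proof.
move=> r_uniq mP m0 t tr; apply/malgP => x; apply/malgP => s.
rewrite !mcoeff0; have [xs|] := eqVneq (len x + s) t; last first.
  by have /PC_degP := mP t; apply.
have /(congr1 (fun c : PC_mod n => c@_x@_s)) := m0.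
rewrite (big_rem t tr) /= !mcoeffD !mcoeff0 raddf_sum raddf_sum /=.
rewrite big_seq big1 ?addr0 // => u ur.
have /PC_degP := mP u; apply; rewrite xs.
by apply: contraTneq ur => <-; rewrite mem_rem_uniqF.
Qed.

Definition PC_graded n : gradedMod K R :=
  @GradedMod K R (PC_mod n) (@PC_deg n) (@PC_degB n) (@PC_degZ n) (@PC_dec n)
    (@PC_indep n).

Lemma len_face n i (x : Z n.+1) : len (face i x) <= len x.
Proof. exact: len_le. Qed.

Fact PC_d_deg n t (c : PC_mod n.+1) :
  c \in @PC_deg n.+1 t -> PC_d c \in @PC_deg n t.
Proof.
move=> cP; rewrite /PC_d big_seq rpred_sum // => x _.
rewrite scaler_sumr rpred_sum // => i _.
rewrite [c@_x]monalgE scaler_suml big_seq rpred_sum // => s sx.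
have <- : len (face i x) + (s + Rge0_sub (len x) (len (face i x))) = t.
  rewrite addrCA Rge0_subK ?len_face // addrC.
  by move/asboolP: cP; apply.
rewrite -malgZU scalerA mulrC -scalerA rpredZsign malgZU.
rewrite /Tpow malgM_def fgmulUU mulr1; exact: PC_degU.
Qed.

Lemma PC_d_dgen n (x : Z n.+2) : PC_d (PC_dgen x) = 0.
Proof.
pose g (p : 'I_n.+3 * 'I_n.+2) : PC_mod n :=
  << Tpow K (Rge0_sub (len x) (len (face p.2 (face p.1 x))))
     *g face p.2 (face p.1 x) >>.
have -> : PC_d (PC_dgen x) =
    \sum_(p : 'I_n.+3 * 'I_n.+2) (-1) ^+ (p.1 + p.2) *: g p.
  rewrite /PC_dgen linear_sum.
  rewrite -(pair_bigA _ (fun (i : 'I_n.+3) (j : 'I_n.+2) => (-1) ^+ (i + j) *: g (i, j))) /=.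
  apply: eq_bigr => i _; rewrite PC_dU scaler_sumr; apply: eq_bigr => j _.
  rewrite !malgZU exprD -!mulrA; congr << _ * _ *g _ >>.
  rewrite mulrCA -TpowD; congr (_ * Tpow K _).
  apply: (@Rge0_addI _ (len (face j (face i x)))).
  rewrite addrCA !Rge0_subK ?len_face //; last first.
    exact: le_trans (len_face _ _) (len_face _ _).
  by rewrite addrC Rge0_subK ?len_face.
pose h (p : 'I_n.+3 * 'I_n.+2) : 'I_n.+3 * 'I_n.+2 :=
  if (p.2 < p.1)%N then (inord p.2, inord p.1.-1)
  else (inord p.2.+1, inord p.1).
rewrite (bigID (fun p : 'I_n.+3 * 'I_n.+2 => (p.2 < p.1)%N)) /=.
rewrite [X in _ + X](reindex_onto h h) /=; last first.
  move=> [i j] /=; rewrite /h /= => ij; rewrite (negbTE ij) /=.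
  have i2 : (i < n.+2)%N by rewrite -leqNgt in ij; have := ltn_ord j; lia.
  rewrite !inordK ?ltnS ?ltn_ord //; last by have := ltn_ord j; lia.
  by rewrite leqNgt ij /= !inord_val.
rewrite [X in _ + X](eq_bigl (fun p : 'I_n.+3 * 'I_n.+2 => (p.2 < p.1)%N)); last first.
  move=> [i j] /=; rewrite /h /=.
  have := ltn_ord i; have := ltn_ord j.
  case: (ltnP j i) => ij /= jn iN.
    rewrite !inordK; try lia.
    have -> : (i.-1 < j)%N = false by lia.
    rewrite /=; apply/eqP; congr pair; apply: val_inj; rewrite /= inordK; lia.
  by rewrite !inordK ?andbF //; try lia; rewrite ltnS ij.
rewrite -big_split big1 //= => -[i j] /= ji.
rewrite /h ji /=.
have iN := ltn_ord i; have jN := ltn_ord j.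
have -> : g (inord j, inord i.-1) = g (i, j).
  rewrite /g /= (face_face (i' := inord j) (j' := inord i.-1) x ji) //.
    by rewrite inordK //; lia.
  by rewrite inordK //; lia.
rewrite !inordK; try lia.
rewrite -scalerDl (_ : (i + j = (j + i.-1).+1)%N); last lia.
by rewrite exprS mulN1r addNr scale0r.
Qed.

Fact PC_dd n (c : PC_mod n.+2) : PC_d (PC_d c) = 0.
Proof.
rewrite [PC_d c]/PC_d linear_sum big1 // => x _.
by rewrite linearZ /= PC_d_dgen scaler0.
Qed.

Definition PC : grComplex K R :=
  @GrComplex K R PC_graded (fun n => @PC_d n : {linear _ -> _})
    PC_d_deg PC_dd.

Definition PH n : gradedMod K R := homology_graded PC n.

End PersistenceComplex.

#[short(type="finMetricType")]
HB.structure Definition FinMetric (R : numDomainType) :=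
  {X of Finite X & Metric R X}.

Section TupleSset.
Variable X : choiceType.

Definition tuple_map m n (f : {omorphism 'I_m.+1 -> 'I_n.+1})
  (s : n.+1.-tuple X) : m.+1.-tuple X := [tuple tnth s (f i) | i < m.+1].

Fact tuple_map_id n (s : n.+1.-tuple X) :
  tuple_map (idfun : {omorphism 'I_n.+1 -> 'I_n.+1}) s = s.
Proof. by apply: eq_from_tnth => i; rewrite tnth_mktuple. Qed.

Fact tuple_map_comp m n p (f : {omorphism 'I_n.+1 -> 'I_p.+1})
  (g : {omorphism 'I_m.+1 -> 'I_n.+1}) s :
  tuple_map (f \o g : {omorphism _ -> _}) s = tuple_map g (tuple_map f s).
Proof. by apply: eq_from_tnth => i; rewrite !tnth_mktuple. Qed.

Definition tuple_sset : sset :=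
  @SSet (fun n => n.+1.-tuple X : choiceType) tuple_map tuple_map_id
    tuple_map_comp.
End TupleSset.

Section ProdSset.
Variables Z W : sset.

Definition prod_map m n (f : {omorphism 'I_m.+1 -> 'I_n.+1})
  (x : Z n * W n) : Z m * W m := (ss_map f x.1, ss_map f x.2).

Fact prod_map_id n (x : Z n * W n) :
  prod_map (idfun : {omorphism 'I_n.+1 -> 'I_n.+1}) x = x.
Proof. by case: x => x y; rewrite /prod_map !ss_id. Qed.

Fact prod_map_comp m n p (f : {omorphism 'I_n.+1 -> 'I_p.+1})
  (g : {omorphism 'I_m.+1 -> 'I_n.+1}) x :
  prod_map (f \o g : {omorphism _ -> _}) x = prod_map g (prod_map f x).
Proof. by rewrite /prod_map !ss_comp. Qed.

Definition prod_sset : sset :=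
  @SSet (fun n => (Z n * W n)%type : choiceType) prod_map prod_map_id
    prod_map_comp.
End ProdSset.

Section MaxLength.
Variables (R : realType) (T : Type) (d : T -> T -> R).

(* The default value 0 of the maximum is harmless: d is nonnegative in all      *)
(* uses.                                                                      *)
Definition max_dist n (s : 'I_n.+1 -> T) : R :=
  \big[Num.max/0]_(p : 'I_n.+1 * 'I_n.+1) d (s p.1) (s p.2).

Fact max_dist_ge0 n (s : 'I_n.+1 -> T) : 0 <= max_dist s.
Proof. exact: bigmax_ge_id. Qed.

Definition max_len n (s : 'I_n.+1 -> T) : Rge0 R :=
  exist (fun x : R => 0 <= x) _ (max_dist_ge0 s).

Lemma max_len_comp m n (f : 'I_m.+1 -> 'I_n.+1) (s : 'I_n.+1 -> T) :
  max_len (s \o f) <= max_len s.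
Proof.
rewrite Rge0_leE /= /max_dist; apply: bigmax_le; first exact: max_dist_ge0.
move=> [i j] _ /=.
exact: (le_bigmax _ (fun p : 'I_n.+1 * 'I_n.+1 => d (s p.1) (s p.2)) (f i, f j)).
Qed.

Lemma eq_max_len n (s s' : 'I_n.+1 -> T) : s =1 s' -> max_len s = max_len s'.
Proof. by move=> ss'; congr max_len; apply/funext. Qed.
End MaxLength.

Section MetricSpaces.
Variable R : realType.

Section OneSpace.
Variable X : metricType R.

Definition metric_len n (s : tuple_sset X n) : Rge0 R :=
  max_len (@mdist R X) (tnth s).

Fact metric_len_le m n (f : {omorphism 'I_m.+1 -> 'I_n.+1})
  (s : tuple_sset X n) : metric_len (ss_map f s) <= metric_len s.
Proof.
rewrite /metric_len (@eq_max_len _ _ _ _ _ (tnth s \o f)) ?max_len_comp //.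
by move=> i; rewrite tnth_mktuple.
Qed.

Definition metric_fsset : fsset R := @FSSet R (tuple_sset X) _ metric_len_le.
End OneSpace.

Section SumLength.
Variables Z W : fsset R.

Definition sum_len n (x : prod_sset Z W n) : Rge0 R := len x.1 + len x.2.

Fact sum_len_le m n (f : {omorphism 'I_m.+1 -> 'I_n.+1})
  (x : prod_sset Z W n) : sum_len (ss_map f x) <= sum_len x.
Proof. by rewrite Rge0_leE !val_Rge0D lerD // -Rge0_leE len_le. Qed.

Definition sum_fsset : fsset R := @FSSet R (prod_sset Z W) _ sum_len_le.
End SumLength.

Section SumMetric.
Variables X Y : metricType R.

Definition sum_dist (p q : X * Y) : R := mdist p.1 q.1 + mdist p.2 q.2.

Definition prod_len n (x : prod_sset (tuple_sset X) (tuple_sset Y) n) : Rge0 R :=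
  max_len sum_dist (fun i => (tnth x.1 i, tnth x.2 i)).

Fact prod_len_le m n (f : {omorphism 'I_m.+1 -> 'I_n.+1})
  (x : prod_sset (tuple_sset X) (tuple_sset Y) n) :
  prod_len (ss_map f x) <= prod_len x.
Proof.
rewrite /prod_len.
rewrite (@eq_max_len _ _ _ _ _ ((fun i => (tnth x.1 i, tnth x.2 i)) \o f)).
  exact: max_len_comp.
by move=> i; rewrite !tnth_mktuple.
Qed.

Definition prod_fsset : fsset R :=
  @FSSet R (prod_sset (tuple_sset X) (tuple_sset Y)) _ prod_len_le.
End SumMetric.

Definition diameter (X : finMetricType R) : R :=
  \big[Num.max/0]_(p : X * X) mdist p.1 p.2.

End MetricSpaces.

(* PH_pair is PH_n(X, Y) and PH_prod is PH_n(X x Y): the underlying simplicial *)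
(* set is the same, only the length functions differ.                         *)
Definition PH_pair (K : fieldType) (R : realType) (X Y : metricType R) n :=
  PH K (sum_fsset (metric_fsset X) (metric_fsset Y)) n.

Definition PH_prod (K : fieldType) (R : realType) (X Y : metricType R) n :=
  PH K (prod_fsset X Y) n.

(* Main.v *)
Require Import Defs.
From HB Require Import structures.
From mathcomp Require Import all_boot all_order all_algebra finmap.
From mathcomp Require Import multinomials.monalg.
From mathcomp Require Import boolp reals constructive_ereal ereal.
From mathcomp Require Import metric_structure.

(** PH_n(X, Y) and PH_n(X x Y) are the homologies of the same simplicial set,
    filtered by two length functions.  A maximum of sums is at most the sum of
    the maxima, so l_{X x Y} <= l_X + l_Y.  Conversely l_{X x Y} bounds both
    l_X and l_Y, so bounding the other summand by a diameter yields
    l_X + l_Y <= l_{X x Y} + min(diam X, diam Y)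
    ([prod_len_le_sum_len], [sum_len_le_prod_len]).

    Two length functions l, l' on one simplicial set that differ by at most d
    have d-interleaved persistent homology ([PH_interleaved]).  Indeed the
    free modules of both complexes have the same basis, and rescaling the
    simplex x by T^(l x + d - l' x) maps one complex to the other and raises
    degrees by d.  This is a chain map because the exponents in the composites
    telescope: either way round, the face y of x is multiplied by
    T^(l x + d - l' y).  Composing it with the map in the other direction
    multiplies each simplex by T^(2d), which is exactly the structure map of
    the interleaving condition, and all of this passes to homology
    ([homology_interleaved]). *)

Set Implicit Arguments.
Unset Strict Implicit.
Unset Printing Implicit Defensive.

Import Order.TTheory GRing.Theory Num.Theory.
Local Open Scope ring_scope.

(** * Interleavings from module maps that shift degrees *)

Section ShiftMap.
Variables (K : fieldType) (R : realType) (d : Rge0 R).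

Definition deg_shift (M N : gradedMod K R) (f : M -> N) : Prop :=
  forall t x, x \in gm_deg M t -> f x \in gm_deg N (t + d).

Section PartMap.
Variables (M N : gradedMod K R) (f : {linear M -> N}) (fd : deg_shift f).
Implicit Types t : Rge0 R.

Definition part_map t (x : gm_part M t) : gm_part N (t + d) :=
  exist (fun y : N => y \in gm_deg N (t + d)) _ (fd (valP x)).

Fact part_map_is_linear t : linear (@part_map t).
Proof. by move=> a x y; apply: val_inj; rewrite /= linearP. Qed.
HB.instance Definition _ t :=
  GRing.isLinear.Build K (gm_part M t) (gm_part N (t + d)) *:%R (@part_map t)
    (@part_map_is_linear t).

(** The structure maps are multiplications by powers of T, so naturality is
    the linearity of [f] over the whole ring, not only over [K]. *)
Lemma part_map_natural t t' (h : t <= t') (x : gm_part M t) :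
  gm_map (Rge0_le_add2r d h) (part_map x) = part_map (gm_map h x).
Proof.
apply: val_inj; rewrite /= linearZ; congr (Tpow K _ *: _).
apply: (@Rge0_addI _ (t + d)); rewrite Rge0_subK ?Rge0_le_add2r //.
by rewrite addrAC Rge0_subK.
Qed.

End PartMap.

(** All the conditions of an interleaving, which are indexed by degrees, are
    restrictions to the graded parts of two equations between module maps. *)
Lemma interleaved_of_shift_maps (M N : gradedMod K R) (f : {linear M -> N})
  (g : {linear N -> M}) :
  deg_shift f -> deg_shift g ->
  (forall x, g (f x) = Tpow K (d + d) *: x) ->
  (forall y, f (g y) = Tpow K (d + d) *: y) ->
  interleaved d (pers_of_graded M) (pers_of_graded N).
Proof.
move=> fd gd gf fg.
have sub2 t : Rge0_sub (t + d + d) t = d + d.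
  apply: (@Rge0_addI _ t); rewrite Rge0_subK ?addrA //.
  exact: le_trans (Rge0_le_addr t d) (Rge0_le_addr (t + d) d).
exists (fun t => part_map fd (t := t) :
          {linear gm_part M t -> gm_part N (t + d)}).
exists (fun t => part_map gd (t := t) :
          {linear gm_part N t -> gm_part M (t + d)}).
split=> [t t' h w|t t' h v|t v|t w].
- exact: part_map_natural.
- exact: part_map_natural.
- by apply: val_inj; rewrite /= gf sub2.
- by apply: val_inj; rewrite /= fg sub2.
Qed.

End ShiftMap.

(** * The map induced on homology by a chain map *)

Section HomologyMap.
Variables (K : fieldType) (R : realType) (C D : grComplex K R).
Variable f : forall n, {linear C n -> D n}.
Hypothesis fC : forall n x, gc_d D n (f n.+1 x) = f n (gc_d C n x).
Implicit Types n : nat.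

Local Notation cls E n := (lmod_pi (@boundary_submod _ _ E n)).

Lemma cycle_map n (x : C n) :
  x \in @Defs.cycle _ _ C n -> f n x \in @Defs.cycle _ _ D n.
Proof.
case: n x => [//|n] x; rewrite !inE => /eqP dx.
by rewrite fC dx linear0.
Qed.

Definition cycles_map n (z : cycles C n) : cycles D n :=
  exist (fun y : D n => y \in @Defs.cycle _ _ D n) _ (cycle_map (valP z)).

Fact cycles_map_is_linear n : linear (@cycles_map n).
Proof. by move=> a x y; apply: val_inj; rewrite /= linearP. Qed.
HB.instance Definition _ n :=
  GRing.isLinear.Build _ (cycles C n) (cycles D n) *:%R (@cycles_map n)
    (@cycles_map_is_linear n).

Definition homology_map n (h : homology C n) : homology D n :=
  cls D n (cycles_map (repr h)).

Lemma homology_mapE n (z : cycles C n) :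
  homology_map (cls C n z) = cls D n (cycles_map z).
Proof.
apply/lmod_piP; rewrite -linearB.
have /lmod_piP/asboolP[b zb] : cls C n (repr (cls C n z)) = cls C n z.
  by rewrite /lmod_pi reprK.
by apply/asboolP; exists (f n.+1 b); rewrite fC -zb.
Qed.

Fact homology_map_is_linear n : linear (@homology_map n).
Proof.
move=> a p q; have [x ->] := lmod_pi_surj p; have [y ->] := lmod_pi_surj q.
by rewrite -linearP !homology_mapE -linearP -linearP.
Qed.
HB.instance Definition _ n :=
  GRing.isLinear.Build _ (homology C n) (homology D n) *:%R (@homology_map n)
    (@homology_map_is_linear n).

Lemma homology_map_shift d n :
  deg_shift d (f n) ->
  @deg_shift _ _ d (homology_graded C n) (homology_graded D n)
    (@homology_map n).
Proof.
move=> fd t _ /asboolP[z zt ->]; apply/asboolP; exists (cycles_map z).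
  exact: fd.
exact: homology_mapE.
Qed.

End HomologyMap.

(** The composites are T^(2d) on the nose on chains, so evaluating the induced
    maps on a representing cycle gives T^(2d) on its class. *)
Lemma homology_interleaved (K : fieldType) (R : realType) (d : Rge0 R)
  (C D : grComplex K R)
  (f : forall n, {linear C n -> D n}) (g : forall n, {linear D n -> C n}) n :
  (forall m x, gc_d D m (f m.+1 x) = f m (gc_d C m x)) ->
  (forall m x, gc_d C m (g m.+1 x) = g m (gc_d D m x)) ->
  deg_shift d (f n) -> deg_shift d (g n) ->
  (forall x, g n (f n x) = Tpow K (d + d) *: x) ->
  (forall y, f n (g n y) = Tpow K (d + d) *: y) ->
  interleaved d (pers_of_graded (homology_graded C n))
                (pers_of_graded (homology_graded D n)).
Proof.
move=> fC gC fd gd gf fg.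
apply: (@interleaved_of_shift_maps _ _ d (homology_graded C n)
  (homology_graded D n) (@homology_map _ _ _ _ _ fC n)
  (@homology_map _ _ _ _ _ gC n)).
- exact: homology_map_shift.
- exact: homology_map_shift.
- move=> p; have [z ->] := lmod_pi_surj p.
  rewrite /= !homology_mapE -linearZ; congr lmod_pi; apply: val_inj.
  exact: gf.
- move=> p; have [z ->] := lmod_pi_surj p.
  rewrite /= !homology_mapE -linearZ; congr lmod_pi; apply: val_inj.
  exact: fg.
Qed.

(** * Diagonal endomorphisms of a free module *)

Section Reweight.
Variables (A : comNzRingType) (S : choiceType) (w : S -> A).

Definition reweight (c : {malg A[S]}) : {malg A[S]} :=
  \sum_(x <- msupp c) << c@_x * w x *g x >>.

Lemma reweightE c x : (reweight c)@_x = c@_x * w x.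
Proof.
rewrite /reweight raddf_sum /=; have [xc|xc] := boolP (x \in msupp c).
  rewrite (big_fsetD1 x) //= mcoeffUU big_seq big1 ?addr0 // => y.
  by rewrite in_fsetD1 => /andP[/negPf yx _]; rewrite mcoeffU yx.
rewrite [c@_x]mcoeff_outdom // mul0r big_seq big1 // => y yc.
by rewrite mcoeffU; case: eqP => // yx; rewrite -yx yc in xc.
Qed.

Lemma msupp_reweight c : (msupp (reweight c) `<=` msupp c)%fset.
Proof.
apply/fsubsetP => x; rewrite -!mcoeff_neq0 reweightE.
by apply: contraNneq => ->; rewrite mul0r.
Qed.

Fact reweight_is_linear : linear reweight.
Proof.
move=> a c e; apply/malgP => x.
by rewrite !(reweightE, mcoeffD, mcoeffZ) mulrDl mulrA.
Qed.
HB.instance Definition _ :=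
  GRing.isLinear.Build A {malg A[S]} {malg A[S]} *:%R reweight
    reweight_is_linear.

Lemma reweightU a x : reweight << a *g x >> = << a * w x *g x >>.
Proof.
apply/malgP => y; rewrite reweightE !mcoeffU.
by case: eqP => [->|_]; rewrite ?mulr1n // !mulr0n mul0r.
Qed.

End Reweight.

(** * Two length functions on one simplicial set *)

Section Compare.
Variables (K : fieldType) (R : realType) (Z : sset) (d : Rge0 R).
Variables (l l' : forall n, Z n -> Rge0 R).
Hypothesis l_le : forall m n (f : {omorphism 'I_m.+1 -> 'I_n.+1}) (x : Z n),
  l (ss_map f x) <= l x.
Hypothesis l'_le : forall m n (f : {omorphism 'I_m.+1 -> 'I_n.+1}) (x : Z n),
  l' (ss_map f x) <= l' x.
Hypothesis ll' : forall n (x : Z n), l' x <= l x + d.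
Local Notation C := (PC K (FSSet l_le)).
Local Notation D := (PC K (FSSet l'_le)).

Definition shift_weight n (x : Z n) := Tpow K (Rge0_sub (l x + d) (l' x)).

Definition compare n :
  {linear PC_mod K (FSSet l_le) n -> PC_mod K (FSSet l'_le) n} :=
  reweight (@shift_weight n).

Lemma compareU n a (x : Z n) :
  compare n << a *g x >> = << a * shift_weight x *g x >>.
Proof. exact: reweightU. Qed.

(** The monomial T^u x, of degree l x + u, becomes T^(u + l x + d - l' x) x,
    whose degree for l' is l x + u + d. *)
Lemma compare_shift n : @deg_shift K R d (C n) (D n) (compare n).
Proof.
move=> t c /PC_degP cP; apply/PC_degP => x s xs; rewrite reweightE.
apply: mcoeff_outdom; apply: contra xs => /msuppM_le[u [v [uc]]].
move=> /(fsubsetP msuppU_le); rewrite in_fset1 => /eqP -> ->.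
have /eqP <- : l x + u == t.
  by apply: contraTT uc => /cP; rewrite -mcoeff_eq0 => ->.
by rewrite /= addrCA Rge0_subK // addrA addrAC addrC addrA.
Qed.

(** Both sides multiply the face y of x by T^(l x + d - l' y), once as
    (l x + d - l' x) + (l' x - l' y) and once as
    (l x - l y) + (l y + d - l' y). *)
Lemma compare_PC_dgen n (x : Z n.+1) :
  shift_weight x *: @PC_dgen K R (FSSet l'_le) n x
    = compare n (@PC_dgen K R (FSSet l_le) n x).
Proof.
rewrite /PC_dgen; apply: etrans _ (esym (linear_sum (compare n) _ _ _)).
rewrite scaler_sumr; apply: eq_bigr => i _.
rewrite malgZU compareU; congr << _ *g _ >>.
rewrite mulrCA -mulrA -!TpowD; congr (_ * Tpow K _).
apply: (@Rge0_addI _ (l' (face i x))).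
rewrite addrCA Rge0_subK ?l'_le // addrC Rge0_subK //.
by rewrite addrCA Rge0_subK // addrA [_ + l _]addrC Rge0_subK ?l_le.
Qed.

Lemma compare_chain n (c : C n.+1) :
  gc_d D n (compare n.+1 c) = compare n (gc_d C n c).
Proof.
(* Both differentials can be expanded over the support of [c]. *)
have supp : (msupp (compare n.+1 c) `<=`
             msupp (c : PC_mod K (FSSet l_le) n.+1))%fset.
  exact: msupp_reweight.
apply: etrans (PC_dEw supp) _.
apply: etrans _ (esym (linear_sum (compare n) _ _ _)).
apply: eq_bigr => x _.
apply: etrans _ (esym (linearZ_LR (compare n) _ _)).
apply: etrans (congr1 (fun b => b *: _) (reweightE _ _ _)) _.
apply: etrans (esym (scalerA _ _ _)) _.
apply: (congr1 (fun v => _ *: v)).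
exact: compare_PC_dgen.
Qed.

End Compare.

Section CompareInterleaved.
Variables (K : fieldType) (R : realType) (Z : sset) (d : Rge0 R).
Variables (l l' : forall n, Z n -> Rge0 R).
Hypothesis l_le : forall m n (f : {omorphism 'I_m.+1 -> 'I_n.+1}) (x : Z n),
  l (ss_map f x) <= l x.
Hypothesis l'_le : forall m n (f : {omorphism 'I_m.+1 -> 'I_n.+1}) (x : Z n),
  l' (ss_map f x) <= l' x.
Hypothesis ll' : forall n (x : Z n), l' x <= l x + d.
Hypothesis l'l : forall n (x : Z n), l x <= l' x + d.

Lemma shift_weightM n (x : Z n) :
  shift_weight K d l l' x * shift_weight K d l' l x = Tpow K (d + d).
Proof.
rewrite -TpowD; congr (Tpow K _); apply: (@Rge0_addI _ (l' x + l x)).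
by rewrite addrACA !Rge0_subK // addrACA [l x + l' x]addrC.
Qed.

Lemma compareK n (c : PC_mod K (FSSet l_le) n) :
  compare K d l'_le l_le n (compare K d l_le l'_le n c) = Tpow K (d + d) *: c.
Proof.
apply/malgP => x; apply: etrans (reweightE _ _ _) _.
apply: etrans (congr1 (fun b => b * _) (reweightE _ _ _)) _.
apply: etrans _ (esym (mcoeffZ _ _ _)).
apply: etrans (esym (mulrA _ _ _)) _.
apply: etrans (congr1 _ (shift_weightM _)) _.
exact: mulrC.
Qed.

End CompareInterleaved.

(** The stability theorem for persistent homology at the level of filtered
    simplicial sets: [compare], taken in both directions, is the interleaving
    on chains. *)
Lemma PH_interleaved (K : fieldType) (R : realType) (Z : sset)
  (l l' : forall n, Z n -> Rge0 R)
  (l_le : forall m n (f : {omorphism 'I_m.+1 -> 'I_n.+1}) (x : Z n),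
    l _ (ss_map f x) <= l _ x)
  (l'_le : forall m n (f : {omorphism 'I_m.+1 -> 'I_n.+1}) (x : Z n),
    l' _ (ss_map f x) <= l' _ x) (d : Rge0 R) n :
  (forall m (x : Z m), l' _ x <= l _ x + d) ->
  (forall m (x : Z m), l _ x <= l' _ x + d) ->
  interleaved d (pers_of_graded (PH K (FSSet l_le) n))
                (pers_of_graded (PH K (FSSet l'_le) n)).
Proof.
move=> ll' l'l.
exact: (@homology_interleaved K R d (PC K (FSSet l_le)) (PC K (FSSet l'_le))
  (compare K d l_le l'_le) (compare K d l'_le l_le) n
  (@compare_chain K R Z d l l' l_le l'_le ll')
  (@compare_chain K R Z d l' l l'_le l_le l'l)
  (@compare_shift K R Z d l l' l_le l'_le ll' n)
  (@compare_shift K R Z d l' l l'_le l_le l'l n)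
  (@compareK K R Z d l l' l_le l'_le ll' l'l n)
  (@compareK K R Z d l' l l'_le l_le l'l ll' n)).
Qed.

(** * Lengths for the sum metric *)

Lemma metric_len_le_diameter (R : realType) (X : finMetricType R) n
  (s : tuple_sset X n) : val (metric_len s) <= diameter X.
Proof.
apply: bigmax_le => [|p _]; first exact: bigmax_ge_id.
exact: (le_bigmax _ (fun p : X * X => mdist p.1 p.2) (tnth s p.1, tnth s p.2)).
Qed.

Section ProdLen.
Variables (R : realType) (X Y : metricType R) (n : nat).
Variable x : prod_sset (tuple_sset X) (tuple_sset Y) n.

Lemma prod_len_le_sum_len :
  prod_len x <= sum_len (Z := metric_fsset X) (W := metric_fsset Y) x.
Proof.
rewrite Rge0_leE val_Rge0D; apply: bigmax_le => [|p _].
  by apply: addr_ge0; apply: valP.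
apply: lerD.
  exact: (le_bigmax _ (fun p => mdist (tnth x.1 p.1) (tnth x.1 p.2)) p).
exact: (le_bigmax _ (fun p => mdist (tnth x.2 p.1) (tnth x.2 p.2)) p).
Qed.

Lemma metric_len1_le_prod_len : metric_len x.1 <= prod_len x.
Proof.
rewrite Rge0_leE; apply: bigmax_le => [|p _]; first exact: valP.
apply: le_trans (le_bigmax _ (fun p => sum_dist (tnth x.1 p.1, tnth x.2 p.1)
  (tnth x.1 p.2, tnth x.2 p.2)) p).
by rewrite lerDl mdist_ge0.
Qed.

Lemma metric_len2_le_prod_len : metric_len x.2 <= prod_len x.
Proof.
rewrite Rge0_leE; apply: bigmax_le => [|p _]; first exact: valP.
apply: le_trans (le_bigmax _ (fun p => sum_dist (tnth x.1 p.1, tnth x.2 p.1)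
  (tnth x.1 p.2, tnth x.2 p.2)) p).
by rewrite lerDr mdist_ge0.
Qed.

End ProdLen.

(** Bound one summand of l_X + l_Y by l_{X x Y} and the other one by its
    diameter; the minimum comes from the choice of the summand. *)
Lemma sum_len_le_prod_len (R : realType) (X Y : finMetricType R) n
  (x : prod_sset (tuple_sset X) (tuple_sset Y) n) (d : Rge0 R) :
  val d = Num.min (diameter X) (diameter Y) ->
  sum_len (Z := metric_fsset X) (W := metric_fsset Y) x <= prod_len x + d.
Proof.
move=> dE; rewrite Rge0_leE !val_Rge0D dE addr_minr le_min.
apply/andP; split; last first.
  apply: lerD; first exact: metric_len1_le_prod_len.
  exact: metric_len_le_diameter.
rewrite addrC; apply: lerD; first exact: metric_len2_le_prod_len.
exact: metric_len_le_diameter.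
Qed.

Theorem theorem1p4 (K : fieldType) (R : realType) (X Y : finMetricType R)
  (X_nonempty : (0 < #|X|)%N) (Y_nonempty : (0 < #|Y|)%N) (n : nat) :
  (interleaving_dist (pers_of_graded (PH_pair K X Y n))
                     (pers_of_graded (PH_prod K X Y n))
   <= (Num.min (diameter X) (diameter Y))%:E)%E.
Proof.
have D_ge0 : 0 <= Num.min (diameter X) (diameter Y).
  by rewrite le_min !bigmax_ge_id.
pose d : Rge0 R := exist (fun r : R => 0 <= r) _ D_ge0.
apply: ereal_inf_lbound; exists d => //=.
apply: PH_interleaved => m x; last exact: sum_len_le_prod_len.
exact: le_trans (prod_len_le_sum_len x) (Rge0_le_addr _ _).
Qed.
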